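(* In the setting of the context, let $\beta^{(k)}=\|P^{(k)}H^{-1/2}A^TAH^{-1/2}(I-P^{(k)})\|$, where $P^{(k)}$ is the orthogonal projector onto $\mathrm{span}\{H^{1/2}\hat X^{(k)}\}$. Assume every generalized singular value $\sigma=c/s$ of $(A,B)$ with $c\in[c_{\min},c_{\max}]$ is simple, and define $\delta_i^{(k)}=\min_{j\ne i}|c_i^2-(\hat c_j^{(k)})^2|$, $i=1,\dots,n_{gv}$. Then for $i=1,\dots,n_{gv}$, $$\sin\angle(\hat x_i^{(k)},x_i)_H\le\sqrt{1+\frac{(\beta^{(k)})^2}{(\delta_i^{(k)})^2}}\Bigl(\frac{\gamma_{p+1}}{\gamma_i}\Bigr)^k\|E^{(0)}\|,$$ $$\sin\angle(\hat u_i^{(k)},u_i)\le\frac{\|\Sigma_A\|}{\hat c_i^{(k)}}\sin\angle(\hat x_i^{(k)},x_i)_H,\qquad \sin\angle(\hat v_i^{(k)},v_i)\le\frac{\|\Sigma_B\|}{\hat s_i^{(k)}}\sin\angle(\hat x_i^{(k)},x_i)_H,$$ $$\chi\bigl((\hat\sigma_i^{(k)})^2,\sigma_i^2\bigr)\le 2\sin^2\angle(\hat x_i^{(k)},x_i)_H.$$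
   Context: $A\in\mathbb{R}^{m_1\times n}$, $B\in\mathbb{R}^{m_2\times n}$, $m_1+m_2\ge n$, $[A^T,B^T]^T$ of full column rank; $H=A^TA+B^TB$. GSVD: $U^TAX=\Sigma_A$, $V^TBX=\Sigma_B$, $X=[x_1,\dots,x_n]$ nonsingular with $X^THX=I$, $U,V$ orthogonal, $\Sigma_A^T\Sigma_A=\mathrm{diag}(c_1^2,\dots,c_n^2)$, $\Sigma_B^T\Sigma_B=\mathrm{diag}(s_1^2,\dots,s_n^2)$, $c_i,s_i\ge0$, $c_i^2+s_i^2=1$; for nontrivial $i$ ($0<c_i<1$), $u_i,v_i$ are the columns of $U,V$ with $Ax_i=c_iu_i$, $Bx_i=s_iv_i$, and $\sigma_i=c_i/s_i$. $S=H^{-1}(A^TA-B^TB)$. Given $[c_{\min},c_{\max}]\subset[0,1]$ and degree $d$: $l(z)=2z^2-1$, $\alpha=\arccos(l(c_{\min}))$, $\beta=\arccos(l(c_{\max}))$, $\eta_0=(\alpha-\beta)/\pi$, $\eta_j=2(\sin(j\alpha)-\sin(j\beta))/(j\pi)$, $\rho_{j,d}=\frac{(d+2-j)\sin\frac{\pi}{d+2}\cos\frac{j\pi}{d+2}+\cos\frac{\pi}{d+2}\sin\frac{j\pi}{d+2}}{(d+2)\sin\frac{\pi}{d+2}}$, $P=\sum_{j=0}^d\rho_{j,d}\eta_jT_j(S)$ ($T_j$ Chebyshev polynomials), so $Px_i=\gamma_ix_i$ with $\gamma_i=\psi_d(l(c_i))$, $\psi_d(x)=\sum_j\rho_{j,d}\eta_jT_j(x)$.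 Indexing: $c_1,\dots,c_r\in(c_{\min},c_{\max})$, $c_{r+1},\dots,c_{n_{gv}}\in\{c_{\min},c_{\max}\}$, $c_{n_{gv}+1},\dots,c_n\notin[c_{\min},c_{\max}]$, $\gamma_i$ decreasing within each group. $p\ge n_{gv}$, $X_p=[x_1,\dots,x_p]$, $X_{p,\perp}=[x_{p+1},\dots,x_n]$, $\gamma_p>\gamma_{p+1}$, and $X_p^THX^{(0)}$ nonsingular; $E^{(0)}=X_{p,\perp}^THX^{(0)}(X_p^THX^{(0)})^{-1}$. Algorithm: $X^{(0)}\in\mathbb{R}^{n\times p}$ of full column rank; at iteration $k$: thin QR $X^{(k)}=Q^{(k)}R^{(k)}$, $AQ^{(k)}=Q_1^{(k)}\bar A^{(k)}$, $BQ^{(k)}=Q_2^{(k)}\bar B^{(k)}$ (full column rank assumed); GSVD $\bar A^{(k)}=\bar U^{(k)}\mathrm{diag}(\hat c_i^{(k)})(\bar X^{(k)})^{-1}$, $\bar B^{(k)}=\bar V^{(k)}\mathrm{diag}(\hat s_i^{(k)})(\bar X^{(k)})^{-1}$; $\hat X^{(k)}=Q^{(k)}\bar X^{(k)}$ ($H$-orthonormal), $\hat U^{(k)}=Q_1^{(k)}\bar U^{(k)}$, $\hat V^{(k)}=Q_2^{(k)}\bar V^{(k)}$; Ritz quintuples $(\hat c_i^{(k)},\hat s_i^{(k)},\hat u_i^{(k)},\hat v_i^{(k)},\hat x_i^{(k)})=(\hat c_i^{(k)},\hat s_i^{(k)},\hat U^{(k)}e_i,\hat V^{(k)}e_i,\hat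 X^{(k)}e_i)$, labeled for $i=1,\dots,n_{gv}$ so that $\hat c_1^{(k)},\dots,\hat c_{n_{gv}}^{(k)}$ are in the same order as $c_1,\dots,c_{n_{gv}}$; $\hat\sigma_i^{(k)}=\hat c_i^{(k)}/\hat s_i^{(k)}$; next iterate $X^{(k+1)}=P\hat X^{(k)}$. $H$-angle: $\cos\angle(y,z)_H=\frac{y^THz}{\|H^{1/2}y\|\,\|H^{1/2}z\|}$, $\sin\angle(y,z)_H=\sqrt{1-\cos^2\angle(y,z)_H}$. Chordal metric $\chi(\lambda,\mu)=|\lambda-\mu|/(\sqrt{1+|\lambda|^2}\sqrt{1+|\mu|^2})$. *)

(* Defs.v *)
From HB Require Import structures.
From mathcomp Require Import all_boot all_order all_algebra.
From mathcomp Require Import all_classical all_reals all_analysis.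
Set Implicit Arguments. Unset Strict Implicit. Unset Printing Implicit Defensive.
Import Order.TTheory GRing.Theory Num.Theory.
Local Open Scope ring_scope.

Section CJFEAST.
Variable R : realType.

Definition vnorm m (x : 'cV[R]_m) : R := Num.sqrt (\sum_i (x i 0) ^+ 2).

Definition opnorm m n (M : 'M[R]_(m, n)) : R :=
  sup [set vnorm (M *m x) | x in [set x : 'cV[R]_n | vnorm x <= 1]].

Definition Hmat m1 m2 n (A : 'M[R]_(m1, n)) (B : 'M[R]_(m2, n)) : 'M[R]_n :=
  A^T *m A + B^T *m B.

Definition Smat m1 m2 n (A : 'M[R]_(m1, n)) (B : 'M[R]_(m2, n)) : 'M[R]_n :=
  invmx (Hmat A B) *m (A^T *m A - B^T *m B).

Definition orthogonal_mx m (U : 'M[R]_m) : Prop := U^T *m U = 1%:M.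
Definition orthonormal_cols m p (Q : 'M[R]_(m, p)) : Prop := Q^T *m Q = 1%:M.
Definition upper_trig p (T : 'M[R]_p) : bool := is_trig_mx T^T.

Definition is_Hsqrt n (H Hh : 'M[R]_n) : Prop :=
  Hh^T = Hh /\ (forall y : 'cV[R]_n, y != 0 -> 0 < (y^T *m Hh *m y) 0 0)
  /\ Hh *m Hh = H.

Definition orth_projector n p (P : 'M[R]_n) (Y : 'M[R]_(n, p)) : Prop :=
  P^T = P /\ P *m P = P /\ (P == Y^T)%MS.

Definition colsmx n p (x : nat -> 'cV[R]_n) : 'M[R]_(n, p) :=
  \matrix_(i < n, j < p) x j i 0.
Definition colsmx_from n p (x : nat -> 'cV[R]_n) : 'M[R]_(n, n - p) :=
  \matrix_(i < n, j < n - p) x (p + j)%N i 0.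

(* cos of the H-angle: y^T H z / (||H^{1/2} y|| ||H^{1/2} z||),
   with ||H^{1/2} y|| = sqrt (y^T H y) *)
Definition Hcos n (H : 'M[R]_n) (y z : 'cV[R]_n) : R :=
  (y^T *m H *m z) 0 0 /
  (Num.sqrt ((y^T *m H *m y) 0 0) * Num.sqrt ((z^T *m H *m z) 0 0)).
Definition Hsin n (H : 'M[R]_n) (y z : 'cV[R]_n) : R :=
  Num.sqrt (1 - Hcos H y z ^+ 2).
Definition esin n (y z : 'cV[R]_n) : R := Hsin 1%:M y z.

Definition chordal (a b : R) : R :=
  `|a - b| / (Num.sqrt (1 + a ^+ 2) * Num.sqrt (1 + b ^+ 2)).

Definition lmap (z : R) : R := 2 * z ^+ 2 - 1.

Fixpoint cheb_pair (t : R) (j : nat) : R * R :=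
  match j with
  | 0 => (1, t)
  | j'.+1 => let: (a, b) := cheb_pair t j' in (b, 2 * t * b - a)
  end.
Definition cheb (j : nat) (t : R) : R := (cheb_pair t j).1.

Fixpoint chebmx_pair n (S : 'M[R]_n) (j : nat) : 'M[R]_n * 'M[R]_n :=
  match j with
  | 0 => (1%:M, S)
  | j'.+1 => let: (a, b) := chebmx_pair S j' in (b, 2%:R *: (S *m b) - a)
  end.
Definition chebmx n (j : nat) (S : 'M[R]_n) : 'M[R]_n := (chebmx_pair S j).1.

Definition cj_alpha (cmin : R) : R := acos (lmap cmin).
Definition cj_beta (cmax : R) : R := acos (lmap cmax).

Definition cj_eta (cmin cmax : R) (j : nat) : R :=
  if j is 0 then (cj_alpha cmin - cj_beta cmax) / pi
  else 2 * (sin (j%:R * cj_alpha cmin) - sin (j%:R * cj_beta cmax)) / (j%:R * pi).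

Definition cj_rho (j d : nat) : R :=
  ((d + 2 - j)%N%:R * sin (pi / (d + 2)%N%:R) * cos (j%:R * pi / (d + 2)%N%:R)
   + cos (pi / (d + 2)%N%:R) * sin (j%:R * pi / (d + 2)%N%:R))
  / ((d + 2)%N%:R * sin (pi / (d + 2)%N%:R)).

Definition cj_psi (cmin cmax : R) (d : nat) (t : R) : R :=
  \sum_(j < d.+1) cj_rho j d * cj_eta cmin cmax j * cheb j t.

Definition cj_filter n (cmin cmax : R) (d : nat) (S : 'M[R]_n) : 'M[R]_n :=
  \sum_(j < d.+1) (cj_rho j d * cj_eta cmin cmax j) *: chebmx j S.

Definition cj_gamma (cmin cmax : R) (d : nat) (c : R) : R :=
  cj_psi cmin cmax d (lmap c).

(* delta_i = min_{j <> i} |c_i^2 - chat_j^2|, in \bar R (= +oo if there is no j <> i) *)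
Definition ritz_sep p (ci : R) (ch : nat -> R) (i : nat) : \bar R :=
  \big[mine/+oo%E]_(j < p | (val j != i)) (`|ci ^+ 2 - ch j ^+ 2|)%:E.

End CJFEAST.

Arguments colsmx {R} n p x.
Arguments colsmx_from {R} n p x.
Arguments ritz_sep {R} p ci ch i.

(* Main.v *)
Require Import Defs.
From HB Require Import structures.
From mathcomp Require Import all_boot all_order all_algebra.
From mathcomp Require Import all_classical all_reals all_analysis.
From mathcomp Require Import ring lra zify.
Import Order.TTheory GRing.Theory Num.Theory.
Local Open Scope ring_scope.

(** Write [H = A^T A + B^T B] and [Z = X^T H = X^-1], so that [Z] maps the [H]-norm to the
    Euclidean one and diagonalises the filter.

    The Jackson damping factors are the normalised autocorrelations of [sin (m pi / (d + 2))],
    so the damped kernel is a squared modulus; as the filter coefficients are those of an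
    indicator function, every [gamma_j] is an integral of this kernel over an interval, hence
    positive as soon as [cmin < cmax] (which the spectral gap forces). The iterates therefore
    keep full rank and span the image of [X^(0)] under the [k]-th power of the filter, which
    contains a vector at [H]-distance at most [(gamma_(p+1) / gamma_i)^k |E^(0)|] from [x_i].
    Saad's argument turns this distance to the trial space into the angle with the Ritz vector.
    The bounds on the left vectors apply [A] and [B] to the component of [xhat_i] orthogonal to
    [x_i], and the chordal bound writes [chat_i^2] as a convex combination of the [c_j^2]. *)

Set Implicit Arguments.
Unset Strict Implicit.

(** * Strict positivity of the damped Chebyshev filter *)

Section JacksonKernel.
Variable R : realType.
Implicit Types (b : nat -> R) (t w : R).

(** The squared modulus of the trigonometric polynomial with coefficients [b]: its cosine
    coefficients are the autocorrelations of [b]. *)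
Lemma cos_sin_sum_sqr b w N :
  (\sum_(m < N) b m * cos (m%:R * w)) ^+ 2 + (\sum_(m < N) b m * sin (m%:R * w)) ^+ 2
  = \sum_(m < N) b m ^+ 2
    + 2 * \sum_(j < N) cos (j.+1%:R * w) * \sum_(m < N - j.+1) b m * b (m + j.+1)%N.
Proof.
elim: N => [|N IH]; first by rewrite !big_ord0; ring.
rewrite !(big_ord_recr N) /= subnn big_ord0 mulr0 addr0.
(* The new coefficient [b N] adds one product to each lag; reversing the order of summation matches
   lag [j.+1] with [m = N - j.+1]. *)
have -> : \sum_(j < N) cos (j.+1%:R * w) * \sum_(m < N.+1 - j.+1) b m * b (m + j.+1)%N
  = \sum_(j < N) cos (j.+1%:R * w) * (\sum_(m < N - j.+1) b m * b (m + j.+1)%N)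
    + \sum_(m < N) b m * b N * (cos (m%:R * w) * cos (N%:R * w) + sin (m%:R * w) * sin (N%:R * w)).
  rewrite [X in _ + X](reindex_inj rev_ord_inj) -big_split /=; apply: eq_bigr => j _.
  have jN := ltn_ord j; have -> : (N.+1 - j.+1 = (N - j.+1).+1)%N by lia.
  rewrite big_ord_recr /= mulrDr; congr (_ + _).
  have -> : (N - j.+1 + j.+1)%N = N by lia.
  rewrite -cosB mulrC; congr (_ * _).
  rewrite -[RHS]cosN opprB -mulrBl -natrB; last lia.
  by have -> : (N - (N - j.+1) = j.+1)%N by lia.
have -> : \sum_(m < N) b m * b N *
      (cos (m%:R * w) * cos (N%:R * w) + sin (m%:R * w) * sin (N%:R * w))
   = b N * cos (N%:R * w) * (\sum_(m < N) b m * cos (m%:R * w))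
     + b N * sin (N%:R * w) * (\sum_(m < N) b m * sin (m%:R * w)).
  by rewrite !mulr_sumr -big_split /=; apply: eq_bigr => j _; ring.
have E := cos2Dsin2 (N%:R * w).
rewrite mulrDr addrACA -IH.
transitivity ((\sum_(m < N) b m * cos (m%:R * w)) ^+ 2 + (\sum_(m < N) b m * sin (m%:R * w)) ^+ 2
  + b N ^+ 2 * (cos (N%:R * w) ^+ 2 + sin (N%:R * w) ^+ 2)
  + 2 * (b N * cos (N%:R * w) * (\sum_(m < N) b m * cos (m%:R * w))
     + b N * sin (N%:R * w) * (\sum_(m < N) b m * sin (m%:R * w)))); first by ring.
by rewrite E; ring.
Qed.

(** The factor [4 * sin t] turns each summand into a constant minus a telescoping difference of
    sines, without any division. *)
Lemma sin_autocorrelation t j M :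
  4 * sin t * (\sum_(m < M) sin (m%:R * t) * sin ((m + j)%N%:R * t))
  = 2 * M%:R * sin t * cos (j%:R * t) - sin ((M + M + j)%N%:R * t - t) + sin (j%:R * t - t).
Proof.
elim: M => [|M IH]; first by rewrite big_ord0 !add0n; ring.
rewrite big_ord_recr /= mulrDr IH.
have -> : (M.+1 + M.+1 + j)%N%:R * t - t = (M + M + j)%N%:R * t + t :> R.
  by rewrite !natrD -[M.+1%:R]natr1; ring.
set a := M%:R * t; set e := j%:R * t.
have -> : (M + j)%N%:R * t = a + e by rewrite natrD mulrDl.
have -> : (M + M + j)%N%:R * t = a + (a + e) by rewrite !natrD !mulrDl addrA.
have -> : cos e = cos (a + e) * cos a + sin (a + e) * sin a.
  by rewrite -cosB; congr cos; ring.
rewrite (sinD _ t) (sinB _ t) (cosD a (a + e)) -[M.+1%:R]natr1; ring.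
Qed.

Lemma angle_step_bounds d : 0 < (pi : R) / (d + 2)%N%:R < pi.
Proof.
have N2 : 2 <= (d + 2)%N%:R :> R by rewrite ler_nat; lia.
have p0 := pi_gt0 R.
apply/andP; split; first by apply: divr_gt0 => //; lra.
by rewrite ltr_pdivrMr; [nra | lra].
Qed.

Lemma sin_angle_step_gt0 d : 0 < sin ((pi : R) / (d + 2)%N%:R).
Proof. by apply: sin_gt0_pi; exact: angle_step_bounds. Qed.

(** For [t = pi / (d + 2)] and [M = d + 2 - j] the boundary angle [(2 M + j) t - t] is
    [2 pi - (j t + t)], so the closed form involves only [j t] and [t], as the Jackson factor
    does. *)
Lemma cj_rho_autocorrelation d j : (j <= d.+2)%N ->
  \sum_(m < d.+2 - j) sin (m%:R * (pi / (d + 2)%N%:R)) * sin ((m + j)%N%:R * (pi / (d + 2)%N%:R))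
  = (d + 2)%N%:R / 2 * cj_rho R j d.
Proof.
move=> jd; have := sin_autocorrelation (pi / (d + 2)%N%:R) j (d.+2 - j).
have := sin_angle_step_gt0 d.
have N0 : (d + 2)%N%:R != 0 :> R by rewrite pnatr_eq0; lia.
rewrite /cj_rho -[j%:R * pi / _]mulrA addn2 in N0 *.
set t := pi / _; set S := \sum_(m < _) _ => s0 E.
have Ht : d.+2%:R * t = pi by rewrite /t mulrC divfK.
have E1 : sin ((d.+2 - j + (d.+2 - j) + j)%N%:R * t - t) = - sin (j%:R * t + t).
  have -> : (d.+2 - j + (d.+2 - j) + j)%N%:R * t - t = - (j%:R * t + t) + pi *+ 2.
    rewrite mulr2n -Ht !natrD natrB //; ring.
  by rewrite sinD2pi sinN.
rewrite E1 (sinD _ t) (sinB _ t) in E.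
apply: (@mulfI _ (4 * sin t)); first by rewrite mulf_neq0 ?gt_eqF // ltr0n.
rewrite E; field.
by rewrite gt_eqF //= -(natrD _ 2).
Qed.

Definition jackson_kernel d w : R := 1 + 2 * \sum_(j < d) cj_rho R j.+1 d * cos (j.+1%:R * w).

Lemma cj_rho0 d : cj_rho R 0 d = 1.
Proof.
have N0 : (d + 2)%N%:R != 0 :> R by rewrite pnatr_eq0; lia.
have s0 := sin_angle_step_gt0 d.
by rewrite /cj_rho !mul0r cos0 sin0 subn0 mulr0 addr0 mulr1 divff // mulf_neq0 // gt_eqF.
Qed.

Lemma jackson_kernelE d w (b := fun m => sin (m%:R * (pi / (d + 2)%N%:R)) : R) :
  (d + 2)%N%:R / 2 * jackson_kernel d w
  = (\sum_(m < d.+2) b m * cos (m%:R * w)) ^+ 2 + (\sum_(m < d.+2) b m * sin (m%:R * w)) ^+ 2.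
Proof.
rewrite cos_sin_sum_sqr; have b0 : b 0%N = 0 by rewrite /b mul0r sin0.
have -> : \sum_(m < d.+2) b m ^+ 2 = (d + 2)%N%:R / 2.
  have := @cj_rho_autocorrelation d 0 isT.
  rewrite cj_rho0 mulr1 subn0 => <-; apply: eq_bigr => m _.
  by rewrite addn0 expr2.
(* Lag [d.+2] is an empty sum and lag [d.+1] is [b 0 * b d.+1 = 0]; the [d] lags of the kernel
   remain. *)
rewrite !big_ord_recr /= !subnn big_ord0 mulr0 addr0.
have -> : (d.+2 - d.+1 = 1)%N by lia.
rewrite big_ord1 b0 mul0r mulr0 addr0 /jackson_kernel.
have -> : \sum_(j < d) cos (j.+1%:R * w) * (\sum_(m < d.+2 - j.+1) b m * b (m + j.+1)%N)
  = (d + 2)%N%:R / 2 * \sum_(j < d) cj_rho R j.+1 d * cos (j.+1%:R * w).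
  rewrite mulr_sumr; apply: eq_bigr => j _.
  by rewrite cj_rho_autocorrelation; [ring | have := ltn_ord j; lia].
by ring.
Qed.

Lemma jackson_kernel_ge0 d w : 0 <= jackson_kernel d w.
Proof.
have N0 : 0 < (d + 2)%N%:R / 2 :> R by rewrite divr_gt0 // ltr0n; lia.
by rewrite -(pmulr_rge0 _ N0) jackson_kernelE addr_ge0 ?sqr_ge0.
Qed.

(* [sin (m t)] solves [b (m-1) + b (m+1) = 2 cos t * b m], so the product with
   [cos w - cos t] telescopes. *)
Lemma sin_cos_sum_telescope t w N :
  2 * (cos w - cos t) * (\sum_(m < N.+1) sin (m%:R * t) * cos (m%:R * w))
  = sin t + sin (N%:R * t) * cos (N.+1%:R * w) - sin (N.+1%:R * t) * cos (N%:R * w).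
Proof.
elim: N => [|N IH].
  by rewrite big_ord_recr big_ord0 /= !mul0r sin0 cos0 !mul1r; ring.
rewrite big_ord_recr /= mulrDr IH.
have -> : N%:R = N.+1%:R - 1 :> R by rewrite -natr1; ring.
have -> : N.+2%:R = N.+1%:R + 1 :> R by rewrite -natr1.
set M : R := N.+1%:R.
rewrite !mulrBl !mulrDl !mul1r sinB cosB sinD cosD; ring.
Qed.

(** A zero of the kernel annihilates both squared sums. With [t = pi / (d + 2)] and [N = d.+1] the
    telescoped cosine sum then reads [sin t * (1 + cos ((d + 2) w)) = 0], and [sin t] is
    positive. *)
Lemma jackson_kernel_gt0 d w : cos ((d + 2)%N%:R * w) != -1 -> 0 < jackson_kernel d w.
Proof.
move=> cw; rewrite lt_def jackson_kernel_ge0 andbT; apply: contraNneq cw => K0.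
have /eqP := jackson_kernelE d w; rewrite K0 mulr0 eq_sym paddr_eq0 ?sqr_ge0 // !sqrf_eq0.
move=> /andP[/eqP C0 _].
have := sin_cos_sum_telescope (pi / (d + 2)%N%:R) w d.+1.
rewrite C0 mulr0 addn2.
have N0 : d.+2%:R != 0 :> R by rewrite pnatr_eq0.
have -> : d.+2%:R * (pi / d.+2%:R) = pi :> R by rewrite mulrC divfK.
have -> : d.+1%:R * (pi / d.+2%:R) = pi - pi / d.+2%:R :> R.
  by have -> : d.+1%:R = d.+2%:R - 1 :> R; [rewrite -[d.+2%:R]natr1; ring | field; rewrite -(natrD _ 2)].
rewrite sinB sinpi cospi; set s := sin _ => E.
have s0 : 0 < s by have := sin_angle_step_gt0 d; rewrite addn2.
apply/eqP; apply: (mulfI (lt0r_neq0 s0)).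
by move: E; set q := cos (d.+2%:R * w); lra.
Qed.

(** An antiderivative in [a] of the kernel averaged over the shifts [w] and [- w], in a product form
    that matches the filter term by term. *)
Definition jackson_primitive d w (a : R) : R :=
  a + 2 * \sum_(j < d) cj_rho R j.+1 d * (sin (j.+1%:R * a) * cos (j.+1%:R * w)) / j.+1%:R.

Lemma is_derive_jackson_primitive d w (a : R) :
  is_derive a (1 : R) (jackson_primitive d w)
    ((jackson_kernel d (a - w) + jackson_kernel d (a + w)) / 2).
Proof.
have sumE : (fun y : R =>
    \sum_(j < d) cj_rho R j.+1 d * (sin (j.+1%:R * y) * cos (j.+1%:R * w)) / j.+1%:R)
  = \sum_(j < d) (fun y : R => cj_rho R j.+1 d * (sin (j.+1%:R * y) * cos (j.+1%:R * w)) / j.+1%:R).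
  by apply/funext => y; rewrite fct_sumE.
have D (j : 'I_d) : is_derive a 1
  (fun y : R => cj_rho R j.+1 d * (sin (j.+1%:R * y) * cos (j.+1%:R * w)) / j.+1%:R)
  (cj_rho R j.+1 d * (cos (j.+1%:R * a) * cos (j.+1%:R * w))).
  have Dl : is_derive a 1 (fun y : R => j.+1%:R * y) j.+1%:R.
    by apply: is_derive_eq; rewrite /GRing.scale /= mulr1.
  have Ds : is_derive a 1 (sin \o (fun y : R => j.+1%:R * y)) (cos (j.+1%:R * a) * j.+1%:R).
    exact: is_derive1_comp.
  have -> : (fun y : R => cj_rho R j.+1 d * (sin (j.+1%:R * y) * cos (j.+1%:R * w)) / j.+1%:R)
    = (cj_rho R j.+1 d * cos (j.+1%:R * w) / j.+1%:R) \*: (sin \o (fun y : R => j.+1%:R * y)).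
    by apply/funext => y /=; rewrite /GRing.scale /=; ring.
  apply: is_derive_eq; rewrite /GRing.scale /=; field.
  by rewrite nat1r pnatr_eq0.
have DS := is_derive_sum D.
have -> : jackson_primitive d w = (id : R -> R) + (2 : R) \*:
    \sum_(j < d) (fun y : R => cj_rho R j.+1 d * (sin (j.+1%:R * y) * cos (j.+1%:R * w)) / j.+1%:R).
  by rewrite -sumE; apply/funext.
apply: is_derive_eq; rewrite /jackson_kernel /GRing.scale /=.
transitivity (1 + \sum_(j < d) cj_rho R j.+1 d * cos (j.+1%:R * (a - w))
  + \sum_(j < d) cj_rho R j.+1 d * cos (j.+1%:R * (a + w))); last by field.
rewrite -addrA -big_split /= mulr_sumr; congr (_ + _); apply: eq_bigr => j _.
by rewrite mulrBr mulrDr cosB cosD; ring.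
Qed.

(** A nonnegative derivative gives weak monotonicity. Equality at the endpoints would make the
    primitive constant in between, hence the kernel zero on a whole interval, while its zeros
    require a cosine equal to [-1]. *)
Lemma jackson_primitive_incr d w a1 a2 : a1 < a2 ->
  jackson_primitive d w a1 < jackson_primitive d w a2.
Proof.
move=> a12.
set G := jackson_primitive d w.
pose dG a := (jackson_kernel d (a - w) + jackson_kernel d (a + w)) / 2.
have DG (a : R) : is_derive a (1 : R) G (dG a) by exact: is_derive_jackson_primitive.
have dG0 a : 0 <= dG a by rewrite divr_ge0 // addr_ge0 // jackson_kernel_ge0.
have mono x y : x <= y -> G x <= G y.
  move=> xy; rewrite -subr_ge0.
  have [|z _ ->] := @MVT_segment R G dG x y xy (fun z _ => DG z).
    apply: derivable_within_continuous => z _; exact: ex_derive.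
  by rewrite mulr_ge0 // subr_ge0.
rewrite lt_neqAle (mono _ _ (ltW a12)) andbT; apply/eqP => Geq.
have dG00 z : a1 < z < a2 -> dG z = 0.
  move=> zI; have Gz y : y \in `]a1, a2[ -> G y = G a1.
    rewrite in_itv /= => /andP[ya yb]; apply/eqP; rewrite eq_le {1}Geq.
    by rewrite !mono // ltW.
  have zI' : z \in `]a1, a2[ by rewrite in_itv.
  (* A constant attains its maximum at every interior point, so its derivative [dG z] vanishes
     there. *)
  have [||_ <-] := @derive1_at_max _ G a1 a2 z (ltW a12) _ zI'.
  - by move=> y _; exact: ex_derive.
  - by move=> y /Gz ->; rewrite Gz.
  by have [_ ->] := DG z.
have cosN z : a1 < z < a2 -> cos ((d + 2)%N%:R * (z - w)) = -1.
  move=> /dG00 z0; apply/eqP; apply: contraT => /jackson_kernel_gt0 Kp.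
  by have := jackson_kernel_ge0 d (z + w); rewrite /dG in z0; lra.
have N0 : 0 < (d + 2)%N%:R :> R by rewrite ltr0n; lia.
have p0 := pi_gt0 R.
(* This [h] keeps [z1 + h] inside the interval and [(d + 2) h] in []0, pi]], where the cosine is
   strictly below [cos 0]. *)
pose z1 := (a1 + a2) / 2; pose h := Num.min ((a2 - a1) / 4) (pi / (d + 2)%N%:R).
have h0 : 0 < h by rewrite lt_min; apply/andP; split; [lra | exact: divr_gt0].
have h1 : h <= (a2 - a1) / 4 by rewrite ge_min lexx.
have h2 : (d + 2)%N%:R * h <= pi.
  by rewrite mulrC -ler_pdivlMr // ge_min lexx orbT.
have c1 : cos ((d + 2)%N%:R * (z1 - w)) = -1 by apply: cosN; rewrite /z1; lra.
have : cos ((d + 2)%N%:R * (z1 + h - w)) = -1 by apply: cosN; rewrite /z1; lra.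
have -> : (d + 2)%N%:R * (z1 + h - w) = (d + 2)%N%:R * (z1 - w) + (d + 2)%N%:R * h by ring.
have s1 : sin ((d + 2)%N%:R * (z1 - w)) = 0.
  have := cos2Dsin2 ((d + 2)%N%:R * (z1 - w)); rewrite c1 => E.
  by apply/eqP; rewrite -sqrf_eq0; apply/eqP; lra.
rewrite cosD c1 s1 mul0r subr0 mulN1r => /oppr_inj ch1.
have : cos ((d + 2)%N%:R * h) < cos (0 : R).
  by rewrite ltr_cos ?in_itv /= ?h2 ?lexx ?andbT ?pi_ge0 ?mulr_ge0 ?mulr_gt0 // ltW.
by rewrite cos0 ch1 ltxx.
Qed.

Lemma cheb_cos j w : cheb j (cos w) = cos (j%:R * w).
Proof.
rewrite /cheb; suff -> : cheb_pair (cos w) j = (cos (j%:R * w), cos (j.+1%:R * w)) by [].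
elim: j => [|j IH]; first by rewrite /= mul0r cos0 mul1r.
rewrite /= IH; congr pair.
have -> : j.+2%:R * w = j.+1%:R * w + w :> R by rewrite -[j.+2%:R]natr1; ring.
have -> : j%:R * w = j.+1%:R * w - w :> R by rewrite -[j.+1%:R]natr1; ring.
by rewrite cosB cosD; ring.
Qed.

(** The [cj_eta] are the Fourier cosine coefficients of the indicator of the angles from
    [cj_beta cmax] to [cj_alpha cmin], so the damped sum is, up to [1 / pi], the integral of the
    averaged kernel between these angles. *)
Lemma cj_psi_cos cmin cmax d w :
  cj_psi cmin cmax d (cos w)
  = (jackson_primitive d w (cj_alpha cmin) - jackson_primitive d w (cj_beta cmax)) / (pi : R).
Proof.
have p0 : pi != 0 :> R by rewrite gt_eqF // pi_gt0.
rewrite /cj_psi; under eq_bigr do rewrite cheb_cos.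
rewrite big_ord_recl /= cj_rho0 mul1r mul0r cos0 mulr1 /jackson_primitive.
rewrite opprD addrACA -mulrBr -sumrB [RHS]mulrDl mulr_sumr mulr_suml; congr (_ + _).
apply: eq_bigr => j _; rewrite /bump leq0n add1n.
by move: (pi : R) p0 => q q0; field; rewrite q0 nat1r pnatr_eq0.
Qed.

Lemma lmap_bounds (z : R) : 0 <= z <= 1 -> -1 <= lmap z <= 1.
Proof. by rewrite /lmap => z01; nra. Qed.

(** Since [acos] is decreasing and [lmap] increasing on [[0, 1]], the angle of [cmax] is strictly
    below that of [cmin]. The filter value is then an increment of an increasing primitive, for [c]
    inside and outside the interval alike. *)
Lemma cj_gamma_gt0 cmin cmax d c : 0 <= cmin -> cmin < cmax -> cmax <= 1 -> 0 <= c <= 1 ->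
  0 < cj_gamma cmin cmax d c :> R.
Proof.
move=> a0 ab b1 c01; rewrite /cj_gamma.
have L := @lmap_bounds.
have [cI aI bI] :
    [/\ lmap c \in `[-1, 1], lmap cmin \in `[-1, 1] & lmap cmax \in `[-1, 1]].
  by rewrite !in_itv /= !L //; lra.
rewrite -(acosK cI) cj_psi_cos divr_gt0 ?pi_gt0 // subr_gt0 jackson_primitive_incr //.
rewrite in_itv /= in aI bI; rewrite /cj_alpha /cj_beta.
rewrite -ltr_cos ?in_itv /= ?acos_ge0 ?acos_lepi // !acosK ?in_itv //= /lmap; nra.
Qed.

(** The two angles coincide, so all coefficients vanish; a strict gap between filter values
    therefore excludes [cmin = cmax]. *)
Lemma cj_gamma_degenerate cm d (c : R) : cj_gamma cm cm d c = 0.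
Proof.
rewrite /cj_gamma /cj_psi big1 // => j _.
suff -> : cj_eta cm cm j = 0 by rewrite mulr0 mul0r.
by case: (j : nat) => [|i]; rewrite /cj_eta /cj_alpha /cj_beta subrr ?mulr0 mul0r.
Qed.


End JacksonKernel.

(** * Euclidean norm and spectral norm *)

Section EuclideanNorm.
Variable R : realType.

Lemma dotE m (v w : 'cV[R]_m) : (v^T *m w) 0 0 = \sum_i v i 0 * w i 0.
Proof. by rewrite mxE; apply: eq_bigr => i _; rewrite mxE. Qed.

Lemma dot_sqrE m (v : 'cV[R]_m) : (v^T *m v) 0 0 = \sum_i v i 0 ^+ 2.
Proof. by rewrite dotE. Qed.

Lemma dot_sqr_ge0 m (v : 'cV[R]_m) : 0 <= (v^T *m v) 0 0.
Proof. by rewrite dot_sqrE sumr_ge0 // => i _; rewrite sqr_ge0. Qed.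

Lemma dotC m (v w : 'cV[R]_m) : (v^T *m w) 0 0 = (w^T *m v) 0 0.
Proof. by rewrite !dotE; apply: eq_bigr => i _; rewrite mulrC. Qed.

Lemma dot_sqrB m (v w : 'cV[R]_m) :
  ((v - w)^T *m (v - w)) 0 0 = (v^T *m v) 0 0 - 2 * (v^T *m w) 0 0 + (w^T *m w) 0 0.
Proof.
rewrite !dotE mulr_sumr -sumrB -big_split /=; apply: eq_bigr => i _.
by rewrite !mxE; ring.
Qed.

Lemma dotZr m (a : R) (v w : 'cV[R]_m) : (v^T *m (a *: w)) 0 0 = a * (v^T *m w) 0 0.
Proof. by rewrite -scalemxAr mxE. Qed.

Lemma dot_sqrZ m (a : R) (v : 'cV[R]_m) :
  ((a *: v)^T *m (a *: v)) 0 0 = a ^+ 2 * (v^T *m v) 0 0.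
Proof. by rewrite dotZr dotC dotZr mulrA expr2. Qed.

Lemma vnorm_ge0 m (v : 'cV[R]_m) : 0 <= vnorm v.
Proof. exact: sqrtr_ge0. Qed.

Lemma vnorm_sqr m (v : 'cV[R]_m) : vnorm v ^+ 2 = (v^T *m v) 0 0.
Proof. by rewrite /vnorm -dot_sqrE sqr_sqrtr // dot_sqr_ge0. Qed.

Lemma vnormZ m (a : R) (v : 'cV[R]_m) : vnorm (a *: v) = `|a| * vnorm v.
Proof.
apply/eqP; rewrite -(@eqrXn2 _ 2) ?vnorm_ge0 ?mulr_ge0 ?vnorm_ge0 //.
by rewrite exprMn !vnorm_sqr dot_sqrZ real_normK ?num_real.
Qed.

Lemma vnorm0 m : vnorm (0 : 'cV[R]_m) = 0.
Proof. by rewrite -[0](scale0r 0) vnormZ normr0 mul0r. Qed.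

(** The supremum in [opnorm] dominates its set only if that set is bounded. On the unit ball every
    coordinate has modulus at most [1], so absolute row sums give a bound. *)
Lemma opnorm_has_ub m n (M : 'M[R]_(m, n)) :
  has_ubound [set vnorm (M *m x) | x in [set x : 'cV[R]_n | vnorm x <= 1]]%classic.
Proof.
exists (Num.sqrt (\sum_i (\sum_j `|M i j|) ^+ 2)) => _ /= [x x1 <-].
apply: ler_wsqrtr; apply: ler_sum => i _.
have N0 : 0 <= \sum_j `|M i j| by rewrite sumr_ge0.
rewrite -real_normK ?num_real // lerXn2r ?nnegrE //.
rewrite mxE; apply: le_trans (ler_norm_sum _ _ _) _; apply: ler_sum => j _.
rewrite normrM -[leRHS]mulr1 ler_wpM2l //.
have : x j 0 ^+ 2 <= 1.
  apply: le_trans (_ : vnorm x ^+ 2 <= 1); last by rewrite exprn_ile1 ?vnorm_ge0.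
  rewrite vnorm_sqr dot_sqrE (bigD1 j) //= lerDl sumr_ge0 // => l _.
  by rewrite sqr_ge0.
by rewrite -real_normK ?num_real // expr_le1.
Qed.

Lemma opnorm_ge0 m n (M : 'M[R]_(m, n)) : 0 <= opnorm M.
Proof.
rewrite /opnorm; apply: ub_le_sup; first exact: opnorm_has_ub.
by exists 0; rewrite /= ?mulmx0 vnorm0.
Qed.

Lemma vnorm_mul m n (M : 'M[R]_(m, n)) (x : 'cV[R]_n) : vnorm (M *m x) <= opnorm M * vnorm x.
Proof.
have [x0|xN0] := eqVneq (vnorm x) 0.
  suff -> : x = 0 by rewrite mulmx0 !vnorm0 mulr0.
  have /eqP : vnorm x ^+ 2 = 0 by rewrite x0 expr0n.
  rewrite vnorm_sqr dot_sqrE psumr_eq0 => [/allP xi0|i _]; last exact: sqr_ge0.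
  apply/matrixP => i j; rewrite ord1 mxE; apply/eqP.
  by rewrite -sqrf_eq0; apply: (implyP (xi0 i _)); rewrite ?mem_index_enum.
have x0 : 0 < vnorm x by rewrite lt_def xN0 vnorm_ge0.
rewrite -ler_pdivrMr // mulrC.
have <- : vnorm (M *m ((vnorm x)^-1 *: x)) = (vnorm x)^-1 * vnorm (M *m x).
  by rewrite -scalemxAr vnormZ gtr0_norm // invr_gt0.
rewrite /opnorm; apply: ub_le_sup; first exact: opnorm_has_ub.
exists ((vnorm x)^-1 *: x) => //=.
by rewrite vnormZ gtr0_norm ?invr_gt0 // mulVf.
Qed.

Lemma dot_sqr_mul m n (M : 'M[R]_(m, n)) (x : 'cV[R]_n) :
  ((M *m x)^T *m (M *m x)) 0 0 <= opnorm M ^+ 2 * (x^T *m x) 0 0.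
Proof.
rewrite -!vnorm_sqr -exprMn lerXn2r ?nnegrE ?vnorm_ge0 ?mulr_ge0 ?opnorm_ge0 ?vnorm_ge0 //.
exact: vnorm_mul.
Qed.

End EuclideanNorm.

(** * Angles between vectors and the chordal metric *)

Section Angles.
Variable R : realType.

Lemma Hsin_normalized n (H : 'M[R]_n) (y z : 'cV[R]_n) :
  (y^T *m H *m y) 0 0 = 1 -> (z^T *m H *m z) 0 0 = 1 ->
  Hsin H y z = Num.sqrt (1 - (y^T *m H *m z) 0 0 ^+ 2).
Proof. by move=> y1 z1; rewrite /Hsin /Hcos y1 z1 sqrtr1 mulr1 divr1. Qed.

Lemma esin_normalized n (y z : 'cV[R]_n) :
  (y^T *m y) 0 0 = 1 -> (z^T *m z) 0 0 = 1 ->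
  esin y z = Num.sqrt (1 - (y^T *m z) 0 0 ^+ 2).
Proof. by move=> y1 z1; rewrite /esin Hsin_normalized ?mulmx1. Qed.

Lemma gramE m n (L : 'M[R]_(m, n)) (y z : 'cV[R]_n) :
  (y^T *m (L^T *m L) *m z) 0 0 = ((L *m y)^T *m (L *m z)) 0 0.
Proof. by rewrite trmx_mul !mulmxA. Qed.

(** With [a] and [e] the cosines on the right and on the left, [xh - a xi] has squared [H]-norm
    [1 - a ^+ 2], and its image [ch uh - a c ui] has squared norm at least [ch ^+ 2 * (1 - e ^+ 2)],
    the squared distance from [ch uh] to the line of [ui]. *)
Lemma esin_image_le m n q (L : 'M[R]_(q, n)) (A : 'M[R]_(m, n)) (xh xi : 'cV[R]_n)
  (uh ui : 'cV[R]_m) (ch c sg : R) :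
  let H := L^T *m L in (xh^T *m H *m xh) 0 0 = 1 -> (xi^T *m H *m xi) 0 0 = 1 ->
  (uh^T *m uh) 0 0 = 1 -> (ui^T *m ui) 0 0 = 1 ->
  A *m xh = ch *: uh -> A *m xi = c *: ui -> 0 < ch -> 0 <= sg ->
  (forall z : 'cV_n, ((A *m z)^T *m (A *m z)) 0 0 <= sg ^+ 2 * (z^T *m H *m z) 0 0) ->
  esin uh ui <= sg / ch * Hsin H xh xi.
Proof.
move=> H xh1 xi1 uh1 ui1 Axh Axi ch0 sg0 bnd.
rewrite esin_normalized // Hsin_normalized //.
set e := (uh^T *m ui) 0 0; set a := (xh^T *m H *m xi) 0 0.
have := bnd (xh - a *: xi).
have -> : ((xh - a *: xi)^T *m H *m (xh - a *: xi)) 0 0 = 1 - a ^+ 2.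
  rewrite /a !gramE in xh1 xi1 *.
  by rewrite mulmxBr -scalemxAr dot_sqrB dot_sqrZ dotZr xh1 xi1; ring.
rewrite mulmxBr -scalemxAr Axh Axi dot_sqrB scalerA !dot_sqrZ !dotZr dotC dotZr dotC uh1 ui1 -/e => b1.
have b2 : ch ^+ 2 * (1 - e ^+ 2) <= sg ^+ 2 * (1 - a ^+ 2).
  by apply: le_trans b1; have := sqr_ge0 (ch * e - a * c); nra.
have -> : sg / ch = Num.sqrt ((sg / ch) ^+ 2).
  by rewrite sqrtr_sqr ger0_norm // divr_ge0 // ltW.
rewrite -sqrtrM ?sqr_ge0 //; apply: ler_wsqrtr.
rewrite expr_div_n mulrAC ler_pdivlMr ?exprn_gt0 //; lra.
Qed.

(** As [(c / s) ^+ 2 = s ^- 2 - 1], the numerator is the difference of squared cosines times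
    [sh ^- 2 * s ^- 2]. From [(s ^- 2 - 2) ^+ 2 >= 0] follows [1 + (c / s) ^+ 4 >= s ^- 4 / 2]; two
    such bounds under the root give the constant [2]. *)
Lemma chordal_le (ch sh c s e : R) :
  0 < s -> 0 < sh -> c ^+ 2 + s ^+ 2 = 1 -> ch ^+ 2 + sh ^+ 2 = 1 ->
  `|ch ^+ 2 - c ^+ 2| <= e -> chordal ((ch / sh) ^+ 2) ((c / s) ^+ 2) <= 2 * e.
Proof.
move=> s0 sh0 cs chs ce.
have q0 (z : R) : 0 < 1 + z ^+ 2 by have := sqr_ge0 z; lra.
have half (c' s' : R) : 0 < s' -> c' ^+ 2 + s' ^+ 2 = 1 ->
   (s' ^+ 2)^-1 ^+ 2 / 2 <= 1 + ((c' / s') ^+ 2) ^+ 2.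
  move=> s'0 E; have -> : (c' / s') ^+ 2 = (s' ^+ 2)^-1 - 1.
    rewrite expr_div_n.
    have -> : c' ^+ 2 = 1 - s' ^+ 2 by lra.
    by rewrite mulrBl mul1r divff ?sqrf_eq0 ?gt_eqF.
  by have := sqr_ge0 ((s' ^+ 2)^-1 - 2); nra.
rewrite /chordal -sqrtrM; last exact: ltW (q0 _).
rewrite ler_pdivrMr; last by rewrite sqrtr_gt0 mulr_gt0.
have -> : (ch / sh) ^+ 2 - (c / s) ^+ 2 = (ch ^+ 2 - c ^+ 2) * ((sh ^+ 2)^-1 * (s ^+ 2)^-1).
  rewrite !expr_div_n.
  have -> : ch ^+ 2 = 1 - sh ^+ 2 by lra.
  have -> : c ^+ 2 = 1 - s ^+ 2 by lra.
  by field; rewrite !gt_eqF.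
have i1 : 0 < (sh ^+ 2)^-1 by rewrite invr_gt0 exprn_gt0.
have i2 : 0 < (s ^+ 2)^-1 by rewrite invr_gt0 exprn_gt0.
set i := _^-1 in i1 *; set j := _^-1 in i2 *.
rewrite normrM (gtr0_norm (mulr_gt0 i1 i2)).
have e0 : 0 <= e by apply: le_trans ce.
have : i * j / 2 <= Num.sqrt ((1 + ((ch / sh) ^+ 2) ^+ 2) * (1 + ((c / s) ^+ 2) ^+ 2)).
  have -> : i * j / 2 = Num.sqrt ((i * j / 2) ^+ 2).
    by rewrite sqrtr_sqr gtr0_norm // divr_gt0 // mulr_gt0.
  apply: ler_wsqrtr.
  have -> : (i * j / 2) ^+ 2 = (i ^+ 2 / 2) * (j ^+ 2 / 2) by field.
  by apply: ler_pM; [rewrite divr_ge0 ?sqr_ge0|rewrite divr_ge0 ?sqr_ge0|exact: half|exact: half].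
set w := Num.sqrt _ => ijw.
apply: le_trans (_ : e * (i * j) <= _); first by rewrite ler_wpM2r // ltW // mulr_gt0.
have := ler_wpM2l e0 ijw; lra.
Qed.

End Angles.

(** * Projection onto the trial space and Ritz vectors *)

Section RitzVectors.
Variables (R : realType) (n p : nat) (Y : 'M[R]_(n, p)) (y : 'cV[R]_n).
Hypotheses (Y1 : Y^T *m Y = 1%:M) (y1 : (y^T *m y) 0 0 = 1).

(** By symmetry of [P], its row space is also its column space: [P] fixes the columns of [Y] and
    factors through them, which determines it. *)
Lemma orth_projectorE (P : 'M[R]_n) : orth_projector P Y -> P = Y *m Y^T.
Proof.
case=> Ps [PP /andP[/submxP[D PD] /submxP[F YF]]].
have YP : Y^T *m P = Y^T by rewrite YF -mulmxA PP.
have PY : P = Y *m D^T by rewrite -Ps PD trmx_mul trmxK.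
by rewrite {1}PY -[D^T]mul1mx -Y1 -mulmxA -PY YP.
Qed.

Lemma residual_normE :
  ((y - Y *m (Y^T *m y))^T *m (y - Y *m (Y^T *m y))) 0 0 = 1 - \sum_j (Y^T *m y) j 0 ^+ 2.
Proof.
set q := Y^T *m y.
have E : (y^T *m (Y *m q)) 0 0 = (q^T *m q) 0 0 by rewrite /q trmx_mul trmxK !mulmxA.
have E2 : ((Y *m q)^T *m (Y *m q)) 0 0 = (q^T *m q) 0 0.
  by rewrite trmx_mul -mulmxA (mulmxA Y^T) Y1 mul1mx.
by rewrite dot_sqrB y1 E E2 dot_sqrE; ring.
Qed.

(** Least squares: the right side exceeds the left by the squared norm of [Y^T *m y - t]. *)
Lemma residual_norm_min (t : 'cV[R]_p) :
  1 - \sum_j (Y^T *m y) j 0 ^+ 2 <= ((y - Y *m t)^T *m (y - Y *m t)) 0 0.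
Proof.
set q := Y^T *m y.
have E : (y^T *m (Y *m t)) 0 0 = (q^T *m t) 0 0 by rewrite /q trmx_mul trmxK mulmxA.
have E2 : ((Y *m t)^T *m (Y *m t)) 0 0 = (t^T *m t) 0 0.
  by rewrite trmx_mul -mulmxA (mulmxA Y^T) Y1 mul1mx.
have := dot_sqr_ge0 (q - t).
by rewrite !dot_sqrB y1 E E2 -dot_sqrE; lra.
Qed.

Variables (M : 'M[R]_n) (th : 'rV[R]_p) (lam : R).
Hypotheses (ritz : Y^T *m M *m Y = diag_mx th) (eigy : M *m y = lam *: y).

(* Compressing the eigenvalue equation to the trial space and testing it against
   the Ritz basis gives [(lam - th j) (Y^T y) j] as the coordinates of
   [P M (1 - P) y], where [P = Y Y^T]. *)
Lemma ritz_vector_bound (i : 'I_p) (dl b : R) :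
  0 < dl -> (forall j, j != i -> dl <= `|lam - th 0 j|) ->
  (forall w : 'cV[R]_n, let z := Y *m Y^T *m M *m (1%:M - Y *m Y^T) *m w in
     (z^T *m z) 0 0 <= b ^+ 2 * (w^T *m w) 0 0) ->
  1 - (Y^T *m y) i 0 ^+ 2
  <= (1 + b ^+ 2 / dl ^+ 2) * (1 - \sum_j (Y^T *m y) j 0 ^+ 2).
Proof.
move=> dl0 sep /(_ (y - Y *m (Y^T *m y))) /=.
rewrite residual_normE; set q := Y^T *m y; set S := \sum_j _.
have -> : Y *m Y^T *m M *m (1%:M - Y *m Y^T) *m (y - Y *m q)
  = Y *m (lam *: q - diag_mx th *m q).
  rewrite -[LHS]mulmxA.
  (* The residual is already orthogonal to the trial space. *)
  have -> : (1%:M - Y *m Y^T) *m (y - Y *m q) = y - Y *m q :> 'cV[R]_n.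
    have Z0 : Y^T *m (y - Y *m q) = 0 by rewrite mulmxBr [X in _ - X]mulmxA Y1 mul1mx subrr.
    by rewrite mulmxBl mul1mx -mulmxA Z0 mulmx0 subr0.
  rewrite -!mulmxA; congr (_ *m _).
  by rewrite !mulmxBr eigy -ritz -scalemxAr -/q !mulmxA.
rewrite trmx_mul -mulmxA (mulmxA Y^T) Y1 mul1mx dot_sqrE => bnd.
(* Coordinate [i] is dropped; every other one carries a factor of modulus at least [dl]. *)
have dS : dl ^+ 2 * (S - q i 0 ^+ 2) <= b ^+ 2 * (1 - S).
  apply: le_trans bnd; rewrite /S (bigD1 i) //= addrAC subrr add0r [leRHS](bigD1 i) //=.
  rewrite mulr_sumr -[leLHS]add0r lerD ?sqr_ge0 //; apply: ler_sum => j ji.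
  rewrite mul_diag_mx !mxE -/(q j 0) -mulrBl exprMn ler_wpM2r ?sqr_ge0 //.
  by rewrite -[leRHS]real_normK ?num_real // lerXn2r ?nnegrE ?sep // ltW.
have d2 : 0 < dl ^+ 2 by rewrite exprn_gt0.
rewrite mulrDl mul1r.
have : S - q i 0 ^+ 2 <= b ^+ 2 / dl ^+ 2 * (1 - S).
  by rewrite mulrAC ler_pdivlMr // mulrC.
by lra.
Qed.

End RitzVectors.

(** * Separation of the Ritz values, and the filter on eigenvectors *)

Lemma ritz_sep_le (R : realType) p ci (ch : nat -> R) (i j : 'I_p) (dl : R) :
  ritz_sep p ci ch i = dl%:E -> j != i -> dl <= `|ci ^+ 2 - ch j ^+ 2|.
Proof.
move=> E ji; rewrite -lee_fin -E /ritz_sep; exact: (@bigmin_le_cond _ _ _ _ j).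
Qed.

(** Every term of the minimum is finite, so [+oo] is the value of the empty minimum only, that is of
    [p = 1]. *)
Lemma ritz_sep_pinfty (R : realType) p ci (ch : nat -> R) (i j : 'I_p) :
  ritz_sep p ci ch i = +oo%E -> j = i.
Proof.
move=> E; apply/eqP; apply: contraT => ji.
have : (ritz_sep p ci ch i <= (`|ci ^+ 2 - ch j ^+ 2|)%:E)%E.
  by rewrite /ritz_sep; exact: (@bigmin_le_cond _ _ _ _ j).
by rewrite E leye_eq.
Qed.

Lemma cj_filter_eigen (R : realType) n cmin cmax d (S : 'M[R]_n) (t : R) (y : 'cV[R]_n) :
  S *m y = t *: y -> cj_filter cmin cmax d S *m y = cj_psi cmin cmax d t *: y.
Proof.
move=> Sy; rewrite /cj_filter /cj_psi mulmx_suml scaler_suml; apply: eq_bigr => j _.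
rewrite -scalemxAl -[RHS]scalerA; congr (_ *: _).
rewrite /chebmx /cheb; move: (nat_of_ord j) => {}j.
suff [-> _] : (chebmx_pair S j).1 *m y = (cheb_pair t j).1 *: y /\
          (chebmx_pair S j).2 *m y = (cheb_pair t j).2 *: y by [].
elim: j => [|j] /=; first by rewrite mul1mx scale1r.
case: (chebmx_pair S j) (cheb_pair t j) => [a b] [a' b'] /= [Ea Eb]; split => //.
by rewrite mulmxBl -scalemxAl -mulmxA Eb Ea -scalemxAr Sy !scalerA -scalerBl; congr (_ *: _); ring.
Qed.

(** The maps [w] and [g] are known only through their values, so that matrices of size [n] need no
    cast to [p + q]. *)
Lemma big_ord_cat (V : nmodType) n p q (F : 'I_n -> V) (w : 'I_p -> 'I_n) (g : 'I_q -> 'I_n) :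
  n = (p + q)%N -> (forall j, w j = j :> nat) -> (forall j, g j = (p + j)%N :> nat) ->
  \sum_j F j = \sum_j F (w j) + \sum_j F (g j).
Proof.
move=> E; subst n => wE gE; rewrite big_split_ord /=.
by congr (_ + _); apply: eq_bigr => j _; congr F; apply: val_inj; rewrite /= ?wE ?gE.
Qed.

(** * Filtered subspace iteration in the coordinates [Z] *)

Section SubspaceIteration.
Variables (R : realType) (n p q : nat) (Z F : 'M[R]_n) (D : 'rV[R]_n).
Variables (w : 'I_p -> 'I_n) (g : 'I_q -> 'I_n).
Hypotheses (npq : n = (p + q)%N) (wE : forall j, w j = j :> nat)
  (gE : forall j, g j = (p + j)%N :> nat).
Hypothesis ZF : Z *m F = diag_mx D *m Z.
Hypothesis D_neq0 : forall j, D 0 (w j) != 0.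
Variable X0 : 'M[R]_(n, p).
Hypothesis G_unit : rowsub w (Z *m X0) \in unitmx.

Let Dpow k := diag_mx (\row_j D 0 j ^+ k).

Lemma Dpow_mulE k m (C : 'M[R]_(n, m)) i j : (Dpow k *m C) i j = D 0 i ^+ k * C i j.
Proof. by rewrite /Dpow mul_diag_mx !mxE. Qed.

(** The filter is diagonal in these coordinates, while QR and the projected GSVD only recombine
    columns; [W] collects these changes of basis. *)
Lemma subspace_iteration (Xk Q : nat -> 'M[R]_(n, p)) (Rq Xb : nat -> 'M[R]_p) :
  Xk 0%N = X0 -> (forall k, Xk k = Q k *m Rq k) -> (forall k, Xb k \in unitmx) ->
  (forall k, Xk k.+1 = F *m (Q k *m Xb k)) ->
  forall k, exists2 W, W \in unitmx & Z *m (Q k *m Xb k) = Dpow k *m (Z *m X0) *m W.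
Proof.
move=> X00 XQ Xbu Xnext.
have step k W : W \in unitmx -> Z *m Xk k = Dpow k *m (Z *m X0) *m W ->
    exists2 W, W \in unitmx & Z *m (Q k *m Xb k) = Dpow k *m (Z *m X0) *m W.
  move=> Wu E.
  (* The rows selected by [w] form a product of three invertible matrices, the diagonal one because
     no filter value vanishes, and this block has [Rq k] as right factor. *)
  have Ru : Rq k \in unitmx.
    have : rowsub w (Z *m Xk k) \in unitmx.
      rewrite E; have -> : rowsub w (Dpow k *m (Z *m X0) *m W)
          = diag_mx (\row_j D 0 (w j) ^+ k) *m rowsub w (Z *m X0) *m W.
        rewrite -mul_rowsub_mx; congr (_ *m _); apply/matrixP => a b.
        by rewrite [LHS]mxE Dpow_mulE mul_diag_mx [RHS]mxE [in RHS]mxE [rowsub _ _ _ _]mxE.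
      rewrite !unitmx_mul G_unit Wu !andbT unitmxE det_diag unitfE.
      by apply/prodf_neq0 => j _; rewrite mxE expf_neq0.
    by rewrite XQ mulmxA -mul_rowsub_mx unitmx_mul => /andP[].
  exists (W *m invmx (Rq k) *m Xb k); first by rewrite !unitmx_mul Wu unitmx_inv Ru Xbu.
  have -> : Q k = Xk k *m invmx (Rq k) by rewrite XQ mulmxK.
  by rewrite !mulmxA E !mulmxA.
elim=> [|k [W Wu E]].
  apply: (@step 0%N 1%:M); first exact: unitmx1.
  rewrite X00 mulmx1; apply/matrixP => a b.
  by rewrite Dpow_mulE expr0 mul1r.
apply: (step _ W) => //.
rewrite Xnext mulmxA ZF -mulmxA E; apply/matrixP => a b.
by rewrite mul_diag_mx [LHS]mxE -!(mulmxA (Dpow _)) !Dpow_mulE exprS mulrA.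
Qed.

Lemma iterate_distance (gp : R) (k : nat) (Xh : 'M[R]_(n, p)) (W : 'M[R]_p)
    (i : 'I_p) (xi : 'cV[R]_n) :
  (forall j, 0 <= D 0 (g j) <= gp) -> 0 < D 0 (w i) ->
  W \in unitmx -> Z *m Xh = Dpow k *m (Z *m X0) *m W -> Z *m xi = delta_mx (w i) 0 ->
  let E0 := rowsub g (Z *m X0) *m invmx (rowsub w (Z *m X0)) in
  exists t : 'cV[R]_p, ((Z *m (xi - Xh *m t))^T *m (Z *m (xi - Xh *m t))) 0 0
    <= ((gp / D 0 (w i)) ^+ k * opnorm E0) ^+ 2.
Proof.
move=> Dg Di Wu ZX Zxi E0.
pose G := rowsub w (Z *m X0); have Gu : G \in unitmx by [].
pose a : 'cV[R]_n := Z *m X0 *m (invmx G *m delta_mx i 0).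
(* Undoing [W] and [G] and rescaling makes the first [p] coordinates agree exactly with those of
   [xi]. The others are, up to sign, those of column [i] of [E0] damped by
   [(D 0 (g j) / D 0 (w i)) ^+ k]. *)
exists (D 0 (w i) ^- k *: (invmx W *m (invmx G *m delta_mx i 0))).
have -> : Z *m (xi - Xh *m (D 0 (w i) ^- k *: (invmx W *m (invmx G *m delta_mx i 0))))
   = delta_mx (w i) 0 - D 0 (w i) ^- k *: (Dpow k *m a).
  rewrite mulmxBr Zxi -scalemxAr -scalemxAr mulmxA ZX; congr (_ - _ *: _).
  by rewrite [LHS]mulmxA mulmxK // /a !mulmxA.
have aw j : a (w j) 0 = (j == i)%:R.
  have <- : (rowsub w a) j 0 = a (w j) 0 by rewrite mxE.
  by rewrite /a -mul_rowsub_mx mulmxA mulmxV // mul1mx mxE eqxx andbT.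
have ag j : a (g j) 0 = (E0 *m delta_mx i 0 : 'cV_q) j 0.
  have <- : (rowsub g a) j 0 = a (g j) 0 by rewrite mxE.
  by rewrite /a -mul_rowsub_mx mulmxA.
rewrite dot_sqrE (big_ord_cat _ npq wE gE).
have Dk0 : D 0 (w i) ^+ k != 0 by rewrite gt_eqF // exprn_gt0.
rewrite big1 ?add0r; last first.
  move=> j _; rewrite 3!mxE [X in _ - X]mxE Dpow_mulE aw eqxx andbT.
  have -> : (w j == w i) = (j == i) by rewrite -!val_eqE /= !wE.
  have [->|_] := eqVneq j i; last by rewrite !mulr0 subr0 expr0n.
  by rewrite mulr1 mulVf // subrr expr0n.
have e1 : ((delta_mx i 0 : 'cV[R]_p)^T *m (delta_mx i 0 : 'cV[R]_p)) 0 0 = 1.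
  rewrite dot_sqrE (bigD1 i) //= big1 ?mxE ?eqxx ?addr0 ?expr1n // => j /negPf ji.
  by rewrite mxE ji expr0n.
have gp0 (j : 'I_q) : 0 <= gp by have /andP[/le_trans h /h] := Dg j.
rewrite exprMn; apply: le_trans (_ : ((gp / D 0 (w i)) ^+ k) ^+ 2 *
  \sum_j (E0 *m delta_mx i 0 : 'cV_q) j 0 ^+ 2 <= _); last first.
  rewrite -dot_sqrE ler_wpM2l ?sqr_ge0 //; apply: le_trans (dot_sqr_mul _ _) _.
  by rewrite e1 mulr1.
rewrite mulr_sumr; apply: ler_sum => j _.
rewrite 3!mxE [X in _ - X]mxE Dpow_mulE ag.
have -> : (g j == w i) = false.
  by apply/negbTE; rewrite -val_eqE /= wE gE; have := ltn_ord i; lia.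
rewrite /= sub0r sqrrN mulrA exprMn ler_wpM2r ?sqr_ge0 //.
have /andP[Dj0 Djg] := Dg j.
rewrite lerXn2r ?nnegrE ?mulr_ge0 ?invr_ge0 ?exprn_ge0 ?divr_ge0 ?(ltW Di) ?(gp0 j) //.
by rewrite mulrC expr_div_n ler_wpM2r ?invr_ge0 ?exprn_ge0 ?(ltW Di) // lerXn2r ?nnegrE ?(gp0 j).
Qed.

End SubspaceIteration.

(** * One factor of the GSVD of the pair *)

Section GSVDFactor.
Variables (R : realType) (m n : nat) (A SA : 'M[R]_(m, n)) (U : 'M[R]_m) (X Z : 'M[R]_n).
Hypotheses (hU : orthogonal_mx U) (hSA : U^T *m A *m X = SA) (XZ : X *m Z = 1%:M).

Lemma gsvd_factorE : A = U *m SA *m Z.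
Proof. by rewrite -hSA -!mulmxA XZ mulmx1 mulmxA (mulmx1C hU) mul1mx. Qed.

Lemma gsvd_gramE : A^T *m A = Z^T *m (SA^T *m SA) *m Z.
Proof.
by rewrite gsvd_factorE !trmx_mul -!mulmxA (mulmxA U^T) hU mul1mx.
Qed.

Lemma gsvd_dot_sqr_le (z : 'cV[R]_n) :
  ((A *m z)^T *m (A *m z)) 0 0 <= opnorm SA ^+ 2 * ((Z *m z)^T *m (Z *m z)) 0 0.
Proof.
have -> : A *m z = U *m (SA *m (Z *m z)) by rewrite {1}gsvd_factorE !mulmxA.
rewrite trmx_mul -mulmxA (mulmxA U^T) hU mul1mx; exact: dot_sqr_mul.
Qed.

End GSVDFactor.

(** * One factor of the projected GSVD *)

Section RitzFactor.
Variables (R : realType) (m n p : nat) (A : 'M[R]_(m, n)) (Q : 'M[R]_(n, p)).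
Variables (Q1 : 'M[R]_(m, p)) (Ab Ub Xb : 'M[R]_p) (ch : nat -> R).
Hypotheses (AQ : A *m Q = Q1 *m Ab) (Q11 : orthonormal_cols Q1) (Ub1 : orthogonal_mx Ub).
Hypotheses (Xbu : Xb \in unitmx) (AbE : Ab = Ub *m diag_mx (\row_(j < p) ch j) *m invmx Xb).

Lemma ritz_factorE : A *m (Q *m Xb) = Q1 *m Ub *m diag_mx (\row_(j < p) ch j).
Proof. by rewrite mulmxA AQ AbE -mulmxA mulmxKV // mulmxA. Qed.

Lemma ritz_left_orthonormal : (Q1 *m Ub)^T *m (Q1 *m Ub) = 1%:M.
Proof. by rewrite trmx_mul -mulmxA (mulmxA Q1^T) Q11 mul1mx Ub1. Qed.

(** Serves twice: as the Ritz condition and, added up over [A] and [B], as the [H]-orthonormality of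
    the trial basis. *)
Lemma ritz_gramE :
  (Q *m Xb)^T *m (A^T *m A) *m (Q *m Xb) = diag_mx (\row_(j < p) ch j ^+ 2).
Proof.
have -> : (Q *m Xb)^T *m (A^T *m A) *m (Q *m Xb) = (A *m (Q *m Xb))^T *m (A *m (Q *m Xb)).
  by rewrite (trmx_mul A) !mulmxA.
rewrite ritz_factorE; have := ritz_left_orthonormal; set L := Q1 *m Ub => L1.
rewrite trmx_mul mulmxA -(mulmxA _ L^T) L1 mulmx1.
rewrite tr_diag_mx mul_diag_mx; apply/matrixP => i j; rewrite !mxE.
by case: eqP => [->|_]; rewrite ?mulr1n ?mulr0n ?mulr0 // expr2.
Qed.

Lemma ritz_factor_col i : A *m col i (Q *m Xb) = ch i *: col i (Q1 *m Ub).
Proof.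
rewrite [in LHS]colE [LHS]mulmxA ritz_factorE -colE mul_mx_diag; apply/matrixP => a b.
by rewrite !mxE mulrC.
Qed.

End RitzFactor.

(** * Bilinear forms on columns and convex combinations *)

Lemma col_dotE (R : realType) m n q (L : 'M[R]_(m, n)) (L' : 'M[R]_(m, q)) i j :
  ((col i L)^T *m col j L') 0 0 = (L^T *m L') i j.
Proof. by rewrite dotE mxE; apply: eq_bigr => a _; rewrite !mxE. Qed.

(* [\sum_j d j w_j^2] is a convex combination of the [d j], with weight [w_i^2] on [d i]. *)
Lemma convex_comb_dist (R : realType) n (d : 'rV[R]_n) (w : 'cV[R]_n) (i : 'I_n) :
  (forall j, 0 <= d 0 j <= 1) -> \sum_j w j 0 ^+ 2 = 1 ->
  `|\sum_j d 0 j * w j 0 ^+ 2 - d 0 i| <= 1 - w i 0 ^+ 2.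
Proof.
move=> d01 w1.
have -> : \sum_j d 0 j * w j 0 ^+ 2 - d 0 i = \sum_(j | j != i) (d 0 j - d 0 i) * w j 0 ^+ 2.
  rewrite -[X in _ - X]mulr1 -w1 mulr_sumr -sumrB (bigD1 i) //= subrr add0r.
  by apply: eq_bigr => j _; rewrite mulrBl.
have -> : 1 - w i 0 ^+ 2 = \sum_(j | j != i) w j 0 ^+ 2.
  by rewrite -w1 (bigD1 i) //= addrAC subrr add0r.
apply: le_trans (ler_norm_sum _ _ _) _; apply: ler_sum => j _.
rewrite normrM (ger0_norm (sqr_ge0 _)) -[leRHS]mul1r ler_wpM2r ?sqr_ge0 //.
by have := d01 i; have := d01 j; rewrite ler_norml; lra.
Qed.

Lemma col_formE (R : realType) m n q (G : 'M[R]_m) (L : 'M[R]_(m, n)) (L' : 'M[R]_(m, q)) i j :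
  ((col i L)^T *m G *m col j L') 0 0 = (L^T *m G *m L') i j.
Proof.
have E : G *m col j L' = col j (G *m L') by rewrite !colE mulmxA.
by rewrite -mulmxA E col_dotE mulmxA.
Qed.

Lemma diag_formE (R : realType) m n (e : 'rV[R]_m) (L : 'M[R]_(m, n)) (v : 'cV[R]_n) :
  (v^T *m (L^T *m diag_mx e *m L) *m v) 0 0 = \sum_j e 0 j * (L *m v) j 0 ^+ 2.
Proof.
rewrite -!mulmxA (mulmxA v^T) -trmx_mul mul_diag_mx dotE.
by move: (L *m v) => z; apply: eq_bigr => j _; rewrite !mxE; ring.
Qed.

(* Indices are 0-based: paper's index i (1-based) is i-1 here; gamma_{p+1} is cj_gamma .. (c p). *)
Theorem theorem4p2
  (R : realType) (m1 m2 n : nat)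
  (A : 'M[R]_(m1, n)) (B : 'M[R]_(m2, n))
  (hm : (n <= m1 + m2)%N) (hrk : \rank (col_mx A B) = n)
  (* GSVD of (A, B) *)
  (U : 'M[R]_m1) (V : 'M[R]_m2) (SA : 'M[R]_(m1, n)) (SB : 'M[R]_(m2, n))
  (x : nat -> 'cV[R]_n) (c s : nat -> R)
  (u : nat -> 'cV[R]_m1) (v : nat -> 'cV[R]_m2)
  (hU : orthogonal_mx U) (hV : orthogonal_mx V)
  (hXu : colsmx n n x \in unitmx)
  (hXH : (colsmx n n x)^T *m Hmat A B *m colsmx n n x = 1%:M)
  (hSA : U^T *m A *m colsmx n n x = SA) (hSB : V^T *m B *m colsmx n n x = SB)
  (hSAd : SA^T *m SA = diag_mx (\row_(i < n) c i ^+ 2))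
  (hSBd : SB^T *m SB = diag_mx (\row_(i < n) s i ^+ 2))
  (hcs : forall i, (i < n)%N -> 0 <= c i /\ 0 <= s i /\ c i ^+ 2 + s i ^+ 2 = 1)
  (hu : forall i, (i < n)%N -> 0 < c i < 1 ->
          (exists j, u i = col j U) /\ A *m x i = c i *: u i)
  (hv : forall i, (i < n)%N -> 0 < c i < 1 ->
          (exists j, v i = col j V) /\ B *m x i = s i *: v i)
  (* interval and filter degree *)
  (cmin cmax : R) (hc : 0 <= cmin /\ cmin <= cmax /\ cmax <= 1) (d : nat)
  (* indexing *)
  (r ngv p : nat) (hr : (r <= ngv)%N) (hngv : (ngv <= p)%N) (hpn : (p < n)%N)
  (hg1 : forall i, (i < r)%N -> cmin < c i < cmax)
  (hg2 : forall i, (r <= i < ngv)%N -> c i = cmin \/ c i = cmax)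
  (hg3 : forall i, (ngv <= i < n)%N -> c i < cmin \/ cmax < c i)
  (hdec1 : forall i j, (i <= j < r)%N ->
     cj_gamma cmin cmax d (c j) <= cj_gamma cmin cmax d (c i))
  (hdec2 : forall i j, (r <= i)%N -> (i <= j < ngv)%N ->
     cj_gamma cmin cmax d (c j) <= cj_gamma cmin cmax d (c i))
  (hdec3 : forall i j, (ngv <= i)%N -> (i <= j < n)%N ->
     cj_gamma cmin cmax d (c j) <= cj_gamma cmin cmax d (c i))
  (hgap : cj_gamma cmin cmax d (c p) < cj_gamma cmin cmax d (c p.-1))
  (* simplicity of the generalized singular values with c in [cmin, cmax] *)
  (hsimple : forall i j, (i < n)%N -> (j < n)%N -> cmin <= c i <= cmax ->
     i != j -> c j != c i)
  (* the iteration *)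
  (Xk : nat -> 'M[R]_(n, p)) (Q : nat -> 'M[R]_(n, p)) (Rq : nat -> 'M[R]_p)
  (Q1 : nat -> 'M[R]_(m1, p)) (Ab : nat -> 'M[R]_p)
  (Q2 : nat -> 'M[R]_(m2, p)) (Bb : nat -> 'M[R]_p)
  (Ub Vb Xb : nat -> 'M[R]_p) (ch sh : nat -> nat -> R)
  (hX0 : \rank (Xk 0%N) = p)
  (hE0 : (colsmx n p x)^T *m Hmat A B *m Xk 0%N \in unitmx)
  (hQR : forall k, Xk k = Q k *m Rq k /\ orthonormal_cols (Q k) /\ upper_trig (Rq k))
  (hQA : forall k, A *m Q k = Q1 k *m Ab k /\ orthonormal_cols (Q1 k)
           /\ upper_trig (Ab k) /\ \rank (A *m Q k) = p)
  (hQB : forall k, B *m Q k = Q2 k *m Bb k /\ orthonormal_cols (Q2 k)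
           /\ upper_trig (Bb k) /\ \rank (B *m Q k) = p)
  (hgsvd : forall k, orthogonal_mx (Ub k) /\ orthogonal_mx (Vb k)
           /\ Xb k \in unitmx
           /\ Ab k = Ub k *m diag_mx (\row_(j < p) ch k j) *m invmx (Xb k)
           /\ Bb k = Vb k *m diag_mx (\row_(j < p) sh k j) *m invmx (Xb k)
           /\ (forall j, (j < p)%N ->
                 0 <= ch k j /\ 0 <= sh k j /\ ch k j ^+ 2 + sh k j ^+ 2 = 1))
  (hlabel : forall k i j, (i < ngv)%N -> (j < ngv)%N -> c i < c j -> ch k i <= ch k j)
  (hnext : forall k, Xk k.+1 = cj_filter cmin cmax d (Smat A B) *m (Q k *m Xb k))
  (* H^{1/2} and the projectors P^{(k)} onto span{H^{1/2} Xhat^{(k)}} *)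
  (Hh : 'M[R]_n) (hHh : is_Hsqrt (Hmat A B) Hh)
  (Pk : nat -> 'M[R]_n) (hPk : forall k, orth_projector (Pk k) (Hh *m (Q k *m Xb k))) :
  forall (k : nat) (i : 'I_p), (val i < ngv)%N ->
  let H := Hmat A B in
  let xhat := col i (Q k *m Xb k) in
  let uhat := col i (Q1 k *m Ub k) in
  let vhat := col i (Q2 k *m Vb k) in
  let sinx := Hsin H xhat (x i) in
  let gam := cj_gamma cmin cmax d in
  let E0 := (colsmx_from n p x)^T *m H *m Xk 0%N
              *m invmx ((colsmx n p x)^T *m H *m Xk 0%N) in
  let rate := (gam (c p) / gam (c i)) ^+ k * opnorm E0 in
  let betak := opnorm (Pk k *m invmx Hh *m (A^T *m A) *m invmx Hh *m (1%:M - Pk k)) in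
  let delta := ritz_sep p (c i) (ch k) i in
  (gam (c i) != 0 ->
     (delta = +oo%E -> sinx <= rate) /\
     (forall dl : R, delta = dl%:E -> 0 < dl ->
        sinx <= Num.sqrt (1 + betak ^+ 2 / dl ^+ 2) * rate))
  /\ (0 < c i < 1 -> 0 < ch k i -> esin uhat (u i) <= opnorm SA / ch k i * sinx)
  /\ (0 < c i < 1 -> 0 < sh k i -> esin vhat (v i) <= opnorm SB / sh k i * sinx)
  /\ (0 < c i < 1 -> 0 < sh k i ->
        chordal ((ch k i / sh k i) ^+ 2) ((c i / s i) ^+ 2) <= 2 * sinx ^+ 2).
Proof.
move=> k i ingv H xhat uhat vhat sinx gam E0 rate betak delta.
set X := colsmx n n x in hXu hXH hSA hSB.
pose Z := X^T *m H; have ZX : Z *m X = 1%:M by exact: hXH.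
have XZ : X *m Z = 1%:M by exact: mulmx1C.
have HT : H^T = H by rewrite /H /Hmat linearD /= !trmx_mul !trmxK.
have ZZ : Z^T *m Z = H.
  by rewrite {1}/Z trmx_mul trmxK HT -mulmxA XZ mulmx1.
have [Zu _] := mulmx1_unit ZX.
have Hu : H \in unitmx by rewrite -ZZ unitmx_mul unitmx_tr Zu.
have Hdot (y z : 'cV[R]_n) : (y^T *m H *m z) 0 0 = ((Z *m y)^T *m (Z *m z)) 0 0.
  by rewrite -ZZ gramE.
have xE (j : 'I_n) : x j = X *m delta_mx j 0.
  by rewrite -colE; apply/matrixP => a b; rewrite !mxE ord1.
have Zx (j : 'I_n) : Z *m x j = delta_mx j 0 by rewrite xE mulmxA ZX mul1mx.
have AA : A^T *m A = Z^T *m diag_mx (\row_(j < n) c j ^+ 2) *m Z.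
  by rewrite (gsvd_gramE hU hSA XZ) hSAd.
have BB : B^T *m B = Z^T *m diag_mx (\row_(j < n) s j ^+ 2) *m Z.
  by rewrite (gsvd_gramE hV hSB XZ) hSBd.
have diag_delta (e : 'rV[R]_n) (j : 'I_n) :
    diag_mx e *m delta_mx j 0 = e 0 j *: delta_mx j 0 :> 'cV[R]_n.
  rewrite mul_diag_mx; apply/matrixP => a b; rewrite !mxE.
  by case: eqP => [->|_] //; rewrite !mulr0.
have eigA (j : 'I_n) : A^T *m A *m x j = c j ^+ 2 *: (H *m x j).
  by rewrite AA -mulmxA Zx -mulmxA diag_delta mxE -scalemxAr -(Zx j) mulmxA ZZ.
have eigB (j : 'I_n) : B^T *m B *m x j = s j ^+ 2 *: (H *m x j).
  by rewrite BB -mulmxA Zx -mulmxA diag_delta mxE -scalemxAr -(Zx j) mulmxA ZZ.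
have c01 (j : 'I_n) : 0 <= c j <= 1.
  by have [c0 [s0 E]] := hcs j (ltn_ord j); rewrite c0 /=; nra.
have eigS (j : 'I_n) : Smat A B *m x j = lmap (c j) *: x j.
  rewrite /Smat -mulmxA mulmxBl eigA eigB -scalerBl -scalemxAr mulKmx //.
  by have [_ [_ E]] := hcs j (ltn_ord j); congr (_ *: _); rewrite /lmap; lra.
set F := cj_filter cmin cmax d (Smat A B) in hnext.
have eigF (j : 'I_n) : F *m x j = gam (c j) *: x j by exact: cj_filter_eigen.
pose D : 'rV[R]_n := \row_j gam (c j).
have FX : F *m X = X *m diag_mx D.
  apply/matrixP => a b; rewrite mul_mx_diag.
  have -> : (F *m X) a b = (F *m x b) a 0 by rewrite xE mulmxA -colE [RHS]mxE.
  by rewrite eigF !mxE mulrC.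
have ZF : Z *m F = diag_mx D *m Z.
  by rewrite -[Z *m F]mulmx1 -XZ mulmxA -(mulmxA Z) FX mulmxA ZX mul1mx.
have [cmin0 [cmm cmax1]] := hc.
have cmlt : cmin < cmax.
  rewrite lt_neqAle cmm andbT; apply/eqP => cE.
  by move: hgap; rewrite cE !cj_gamma_degenerate ltxx.
have gam0 (j : 'I_n) : 0 < gam (c j) by exact: cj_gamma_gt0.
pose w : 'I_p -> 'I_n := widen_ord (ltnW hpn).
pose g (j : 'I_(n - p)) : 'I_n := cast_ord (subnKC (ltnW hpn)) (rshift p j).
have wE j : w j = j :> nat by [].
have gE j : g j = (p + j)%N :> nat by [].
(* Row [j] of [Z] is the transpose of [x j] times [H], so both blocks of [E0] are row selections. *)
have colsw : (colsmx n p x)^T *m H *m Xk 0%N = rowsub w (Z *m Xk 0%N).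
  rewrite -mul_rowsub_mx -mul_rowsub_mx; congr (_ *m _ *m _).
  by apply/matrixP => a b; rewrite !mxE.
have colsg : (colsmx_from n p x)^T *m H *m Xk 0%N = rowsub g (Z *m Xk 0%N).
  rewrite -mul_rowsub_mx -mul_rowsub_mx; congr (_ *m _ *m _).
  by apply/matrixP => a b; rewrite !mxE.
have [Ub1 [Vb1 [Xbu [AbE [BbE hch]]]]] := hgsvd k.
have [AQ [Q11 _]] := hQA k; have [BQ [Q21 _]] := hQB k.
pose Xh := Q k *m Xb k; have xhatE : xhat = col i Xh by [].
have XhA := ritz_gramE AQ Q11 Ub1 Xbu AbE.
have XhB := ritz_gramE BQ Q21 Vb1 Xbu BbE.
have XhH : Xh^T *m H *m Xh = 1%:M.
  rewrite /H /Hmat mulmxDr mulmxDl XhA XhB; apply/matrixP => a b.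
  rewrite !mxE; have [_ [_ E]] := hch a (ltn_ord a).
  by case: eqP => _; rewrite ?mulr0n ?addr0 // !mulr1n.
have xi1 : ((x i)^T *m H *m x i) 0 0 = 1.
  rewrite Hdot (Zx (w i)) dot_sqrE (bigD1 (w i)) //= big1 ?mxE ?eqxx ?addr0 ?expr1n // => j /negPf ji.
  by rewrite mxE ji expr0n.
have xh1 : (xhat^T *m H *m xhat) 0 0 = 1.
  by rewrite xhatE col_formE XhH mxE eqxx.
have sinxE : sinx = Num.sqrt (1 - (xhat^T *m H *m x i) 0 0 ^+ 2) by exact: Hsin_normalized.
(* [ch k i ^+ 2] is the Rayleigh quotient of [xhat], an average of the [c j ^+ 2] whose weight at
   [i] is the squared [H]-cosine. *)
have ray : `|ch k i ^+ 2 - c i ^+ 2| <= 1 - (xhat^T *m H *m x i) 0 0 ^+ 2.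
  have -> : (xhat^T *m H *m x i) 0 0 = (Z *m xhat) (w i) 0.
    rewrite Hdot (Zx (w i)) dotC dotE (bigD1 (w i)) //= big1 ?addr0 ?mxE ?eqxx ?mul1r //.
    by move=> j /negPf ji; rewrite mxE ji mul0r.
  have -> : ch k i ^+ 2 = \sum_j (\row_(j < n) c j ^+ 2) 0 j * (Z *m xhat) j 0 ^+ 2.
    have -> : ch k i ^+ 2 = (xhat^T *m (A^T *m A) *m xhat) 0 0.
      by rewrite xhatE col_formE XhA !mxE eqxx mulr1n.
    by rewrite AA diag_formE.
  have -> : c i ^+ 2 = (\row_(j < n) c j ^+ 2) 0 (w i) by rewrite mxE.
  apply: convex_comb_dist; last by rewrite -dot_sqrE -Hdot.
  by move=> j; rewrite mxE; have := c01 j; nra.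
have iN : (i < n)%N by exact: ltn_ord (w i).
have LE : H = Z^T *m Z by [].
split; last split; last split.
- move=> _.
  have [Hs [Hpos HhH]] := hHh; rewrite -/H in HhH.
  have Hhu : Hh \in unitmx by move: Hu; rewrite -HhH unitmx_mul => /andP[].
  (* Multiplication by [Hh] makes the [H]-geometry Euclidean: [Y] is an orthonormal basis of the
     range of [Pk k], and [y] a unit eigenvector of [M] below. *)
  pose Y := Hh *m Xh; pose y := Hh *m x i.
  have Hform m q (L : 'M[R]_(n, m)) (L' : 'M[R]_(n, q)) :
      (Hh *m L)^T *m (Hh *m L') = L^T *m H *m L'.
    by rewrite trmx_mul Hs -HhH !mulmxA.
  have Y1 : Y^T *m Y = 1%:M by rewrite /Y Hform.
  have y1 : (y^T *m y) 0 0 = 1 by rewrite /y Hform.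
  have Yy : (Y^T *m y) i 0 = (xhat^T *m H *m x i) 0 0.
    have xc : col 0 (x i) = x i by apply/matrixP => a b; rewrite !mxE ord1.
    by rewrite /Y /y Hform xhatE -[in RHS]xc col_formE.
  pose M := invmx Hh *m (A^T *m A) *m invmx Hh.
  have ritz : Y^T *m M *m Y = diag_mx (\row_(j < p) ch k j ^+ 2).
    have Mform (L : 'M[R]_(n, p)) : (Hh *m L)^T *m M *m (Hh *m L) = L^T *m (A^T *m A) *m L.
      by rewrite trmx_mul Hs /M !mulmxA mulmxK // -(mulmxA _ (invmx Hh) Hh) mulVmx // mulmx1.
    by rewrite /Y Mform XhA.
  have eigy : M *m y = c i ^+ 2 *: y.
    by rewrite /M /y -mulmxA mulKmx // -mulmxA (eigA (w i)) -scalemxAr -HhH -mulmxA mulKmx.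
  (* The squared distance from [y] to the trial space, which the iteration makes small. *)
  pose res := 1 - \sum_j (Y^T *m y) j 0 ^+ 2.
  have rate0 : 0 <= rate.
    rewrite mulr_ge0 ?opnorm_ge0 // exprn_ge0 // divr_ge0 // ltW //.
      exact: (gam0 (Ordinal hpn)).
    exact: (gam0 (w i)).
  have resle : res <= rate ^+ 2.
    have Gu : rowsub w (Z *m Xk 0%N) \in unitmx by rewrite -colsw.
    have Dw j : D 0 (w j) != 0 by rewrite mxE gt_eqF.
    have [W Wu WE] := subspace_iteration ZF Dw Gu erefl
      (fun l => (hQR l).1) (fun l => (hgsvd l).2.2.1) hnext k.
    (* Since [ngv <= p], all indices from [p] on lie in the third group, where the filter values
       decrease. *)
    have Dg j : 0 <= D 0 (g j) <= gam (c p).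
      rewrite mxE (ltW (gam0 _)) andTb; apply: hdec3 => //.
      by have := ltn_ord (g j); rewrite /= leq_addr.
    have Di : 0 < D 0 (w i) by rewrite mxE.
    have [t tle] := iterate_distance (esym (subnKC (ltnW hpn)))
      wE gE Gu Dg Di Wu WE (Zx (w i)).
    apply: le_trans (residual_norm_min Y1 y1 t) _.
    rewrite /y /Y -mulmxA -mulmxBr Hform Hdot; apply: le_trans tle _.
    by rewrite mxE -colsw -colsg.
  have sq (b : R) : 0 <= b -> 1 - (Y^T *m y) i 0 ^+ 2 <= b * res -> sinx <= Num.sqrt b * rate.
    move=> b0 hb; rewrite sinxE -Yy -[rate]ger0_norm // -sqrtr_sqr -sqrtrM //.
    by apply: ler_wsqrtr; apply: le_trans hb _; rewrite ler_wpM2l.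
  split.
  (* With a single Ritz vector the distance to the trial space is the sine itself. *)
  + move=> dinf; rewrite -[rate]mul1r -sqrtr1; apply: sq => //.
    rewrite mul1r /res (bigD1 i) //= big1 ?addr0 // => j.
    by rewrite (ritz_sep_pinfty j dinf) eqxx.
  + move=> dl dlE dl0; apply: sq.
      by rewrite addr_ge0 // divr_ge0 ?sqr_ge0.
    apply: (ritz_vector_bound Y1 y1 ritz eigy) => //.
      by move=> j ji; rewrite mxE; exact: ritz_sep_le dlE ji.
    move=> z; rewrite -(orth_projectorE Y1 (hPk k)) /=.
    have -> : Pk k *m M *m (1%:M - Pk k)
      = Pk k *m invmx Hh *m (A^T *m A) *m invmx Hh *m (1%:M - Pk k) by rewrite /M !mulmxA.
    exact: dot_sqr_mul.
- move=> ci chi; have [[j uj] Axi] := hu i iN ci.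
  rewrite /sinx LE; apply: (@esin_image_le _ _ _ _ Z A _ _ _ _ (ch k i) (c i)) => //.
  + by rewrite ZZ.
  + by rewrite ZZ.
  + by rewrite /uhat col_dotE (ritz_left_orthonormal Q11 Ub1) mxE eqxx.
  + by rewrite uj col_dotE hU mxE eqxx.
  + exact: (ritz_factor_col AQ Xbu AbE).
  + exact: opnorm_ge0.
  + by move=> z; rewrite gramE; exact: (gsvd_dot_sqr_le hU hSA XZ).
- move=> ci shi; have [[j vj] Bxi] := hv i iN ci.
  rewrite /sinx LE; apply: (@esin_image_le _ _ _ _ Z B _ _ _ _ (sh k i) (s i)) => //.
  + by rewrite ZZ.
  + by rewrite ZZ.
  + by rewrite /vhat col_dotE (ritz_left_orthonormal Q21 Vb1) mxE eqxx.
  + by rewrite vj col_dotE hV mxE eqxx.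
  + exact: (ritz_factor_col BQ Xbu BbE).
  + exact: opnorm_ge0.
  + by move=> z; rewrite gramE; exact: (gsvd_dot_sqr_le hV hSB XZ).
(* [ray] also shows that the radicand of [sinx] is nonnegative, so squaring removes the root. *)
- move=> /andP[ci0 ci1] shi; rewrite sinxE sqr_sqrtr; last exact: le_trans ray.
  have [_ [s0 E]] := hcs i iN; have [_ [_ E']] := hch i (ltn_ord i).
  apply: chordal_le => //; rewrite lt_def s0 andbT; apply/eqP => s00.
  have : c i ^+ 2 < 1 by rewrite exprn_ilt1 // ltW.
  by rewrite -E s00 expr0n addr0 ltxx.
Qed.
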